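(* Let $\ell \geq 4$ be an even integer. For every integer $n > 12\ell^2 + 36\ell + 24$, there exists a regular graph on $n$ vertices that is $C_{\ell+1}$-saturated.
   Context: $C_{\ell+1}$ denotes the cycle on $\ell+1$ vertices. A graph $G$ is $F$-free if it contains no subgraph isomorphic to $F$; $G$ is $F$-saturated if $G$ is $F$-free and adding any edge between two non-adjacent vertices of $G$ creates a subgraph isomorphic to $F$. A graph is regular if all its vertices have the same degree. *)

(* Defs.v *)
From mathcomp Require Import all_boot.

Set Implicit Arguments.
Unset Strict Implicit.
Unset Printing Implicit Defensive.

Definition simple_graph (T : finType) (e : rel T) : Prop :=
  symmetric e /\ irreflexive e.

Definition degree (T : finType) (e : rel T) (x : T) : nat :=
  #|[set y | e x y]|.

Definition regular (T : finType) (e : rel T) : Prop :=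
  forall x y : T, degree e x = degree e y.

(* The subgraph is not required to be induced. *)
Definition contains (U T : finType) (F : rel U) (e : rel T) : Prop :=
  exists f : U -> T, injective f /\ (forall u v, F u v -> e (f u) (f v)).

Definition add_edge (T : finType) (e : rel T) (x y : T) : rel T :=
  fun u v => [|| e u v, (u == x) && (v == y) | (u == y) && (v == x)].

Definition saturated (U T : finType) (F : rel U) (e : rel T) : Prop :=
  ~ contains F e /\
  (forall x y : T, x != y -> ~~ e x y -> contains F (add_edge e x y)).

(* [ordS] is the successor modulo [k]; the conjunct [i != j] only matters
   for [k = 1], where it removes the loop. *)
Definition cycle_graph (k : nat) : rel 'I_k :=
  fun i j => (i != j) && ((j == ordS i) || (i == ordS j)).

Lemma cycle_graph_simple (k : nat) : simple_graph (@cycle_graph k).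
Proof.
by split=> [i j | i]; rewrite /cycle_graph ?eqxx // eq_sym orbC.
Qed.

Lemma add_edge_simple (T : finType) (e : rel T) (x y : T) :
  simple_graph e -> x != y -> simple_graph (add_edge e x y).
Proof.
move=> [esym eirr] xy; split=> [u v | u]; rewrite /add_edge.
  by rewrite esym; congr (_ || _); rewrite orbC; congr (_ || _); apply: andbC.
rewrite eirr /=; apply/negP => /orP[] /andP[/eqP ux /eqP uy];
  by rewrite -ux -uy eqxx in xy.
Qed.

(* Main.v *)
(** For even n the complete balanced bipartite graph works. For odd n, write
    n = (l+1)a - 2(2c-1) with a odd and 1 <= c <= l+1, and let
    X = {0} U {z >= c : z <> 2c-1}, a symmetric numerical semigroup with Frobenius
    number 2c-1. Join u and v in Z/n when the odd representative of v - u
    in (-n, n) is, up to sign, of the form a - 2z >= 0 with z in X.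
    The l+1 odd steps around a cycle would add up to an odd multiple of n, hence
    to n or -n, and then the corresponding elements of X would add up to
    2c-1, which is not in X. For non-adjacent x and y, one of y - x and
    x - y has an even representative T > 0; writing T = la - 2z, the symmetry of X
    puts z in X, so T is a sum of l steps a - 2z_i > 0 whose partial sums form
    a path; only T < l needs a different path. *)
Require Import Defs.
From mathcomp Require Import all_boot.
From mathcomp Require Import zify.

Set Implicit Arguments.
Unset Strict Implicit.
Unset Printing Implicit Defensive.

(** * Circulant graphs on Z/n *)

Definition circulant (n : nat) (P : pred nat) : rel 'I_n :=
  fun u v => P ((v + (n - u)) %% n).

Lemma diff_modn (n u v : nat) : u < n -> v < n ->
  (v + (n - u)) %% n = if u <= v then v - u else v + n - u.
Proof.
move=> un vn; case: leqP => uv; last by rewrite modn_small; lia.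
by have -> : v + (n - u) = v - u + n by [lia]; rewrite modnDr modn_small; lia.
Qed.

Lemma add_modn_small (n u s : nat) : u < n -> s < n ->
  (u + s) %% n = if u + s < n then u + s else u + s - n.
Proof.
move=> un sn; case: ltnP => us; first by rewrite modn_small.
by have -> : u + s = u + s - n + n by [lia]; rewrite modnDr modn_small; lia.
Qed.

Lemma diff_shift_modn (n x s t : nat) : x < n -> s < n -> t < n ->
  ((x + t) %% n + (n - (x + s) %% n)) %% n = (t + (n - s)) %% n.
Proof.
move=> xn sn tn; have n0 : 0 < n by lia.
rewrite diff_modn ?ltn_mod // diff_modn // !add_modn_small //.
by do 2![case: ltnP => ?]; do 2![case: leqP => ?]; lia.
Qed.

Lemma addnK_modn (n x d : nat) : x < n -> d < n ->
  ((x + d) %% n + (n - x)) %% n = d.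
Proof.
move=> xn dn; have n0 : 0 < n by lia.
rewrite (add_modn_small xn dn); case: ltnP => ?; rewrite diff_modn //; try lia.
  by rewrite leq_addr addKn.
by case: leqP; lia.
Qed.

Lemma circulant_simple (n : nat) (P : pred nat) :
  ~~ P 0 -> (forall d, 0 < d < n -> P (n - d) = P d) ->
  simple_graph (@circulant n P).
Proof.
move=> P0 PN; split=> [u v | u]; rewrite /circulant; last first.
  by rewrite diff_modn // leqnn subnn; apply: negbTE.
rewrite !diff_modn //; have un := ltn_ord u; have vn := ltn_ord v.
case: (ltngtP u v) => uv; last by rewrite uv subnn.
- by rewrite -PN; [congr P|]; lia.
- by rewrite -[RHS]PN; [congr P|]; lia.
Qed.

(** Translation by [x] maps the residues satisfying [P] bijectively onto the neighbourhood of
    [x]. *)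
Lemma circulant_regular (n : nat) (P : pred nat) : regular (@circulant n P).
Proof.
suff deg x : degree (@circulant n P) x = #|[set d : 'I_n | P d]|.
  by move=> x y; rewrite !deg.
have n0 : 0 < n by apply: leq_trans (ltn_ord x).
pose h (d : 'I_n) := Ordinal (ltn_pmod (x + d) n0).
have hE (d : 'I_n) : (h d + (n - x)) %% n = d by rewrite /= addnK_modn.
have h_inj : injective h.
  by move=> d d' hd; apply: val_inj; rewrite -[LHS]hE hd hE.
rewrite /degree -(on_card_preimset (onW_bij _ (injF_bij h_inj))).
by apply: eq_card => d; rewrite !inE /circulant hE.
Qed.

(** * Closing a path into a cycle with the added edge *)

Lemma cycle_of_path (T : finType) (e : rel T) (k : nat) (x y : T)
    (g : nat -> T) :
  simple_graph e -> x != y -> g 0 = x -> g k = y ->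
  {in [pred i | i <= k] &, injective g} ->
  (forall i, i < k -> e (g i) (g i.+1)) ->
  contains (@cycle_graph k.+1) (add_edge e x y).
Proof.
move=> es xy g0 gk ginj gE; exists (fun i : 'I_k.+1 => g i); split.
  by move=> i j ij; apply: val_inj; apply: ginj ij; rewrite inE -ltnS.
have [asym _] := add_edge_simple es xy.
have step (i : 'I_k.+1) : add_edge e x y (g i) (g (ordS i)).
  rewrite /add_edge /=; have := ltn_ord i; rewrite ltnS leq_eqVlt.
  case/predU1P => [->|ik]; first by rewrite modnn g0 gk !eqxx !orbT.
  by rewrite modn_small // gE.
by move=> u v /andP[_ /orP[]/eqP->] //; rewrite asym.
Qed.

(** Having at least two vertices makes [i] and [ordS i] distinct, hence adjacent in the cycle. *)
Lemma cycle_steps (T : finType) (e : rel T) (k : nat) :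
  contains (@cycle_graph k.+2) e ->
  exists2 f : 'I_k.+2 -> T, injective f & forall i, e (f i) (f (ordS i)).
Proof.
case=> f [finj fE]; exists f => // i; apply: fE.
rewrite /cycle_graph eqxx /= andbT -val_eqE /=.
have := ltn_ord i; rewrite ltnS leq_eqVlt.
case/predU1P => [->|ik]; first by rewrite modnn.
by rewrite modn_small //; lia.
Qed.

Lemma add_edgeC (T : finType) (e : rel T) (x y : T) :
  add_edge e x y =2 add_edge e y x.
Proof. by move=> u v; rewrite /add_edge; congr (_ || _); rewrite orbC. Qed.

Lemma contains_add_edgeC (U T : finType) (F : rel U) (e : rel T) (x y : T) :
  contains F (add_edge e x y) -> contains F (add_edge e y x).
Proof. by case=> f [fi fE]; exists f; split=> // u v /fE; rewrite add_edgeC. Qed.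

(** Here [s i] is the offset from [x] of the [i]-th vertex of a path from [x] to [y]. *)
Lemma circulant_cycle (n k : nat) (P : pred nat) (s : nat -> nat) (x y : 'I_n) :
  simple_graph (@circulant n P) -> x != y ->
  s 0 = 0 -> s k = (y + (n - x)) %% n ->
  (forall i, i <= k -> s i < n) ->
  {in [pred i | i <= k] &, injective s} ->
  (forall i, i < k -> P ((s i.+1 + (n - s i)) %% n)) ->
  contains (@cycle_graph k.+1) (add_edge (@circulant n P) x y).
Proof.
move=> es xy s0 sk sn sinj sP.
have n0 : 0 < n by apply: leq_trans (ltn_ord x).
pose g i := Ordinal (ltn_pmod (x + s i) n0).
have gK i : i <= k -> (g i + (n - x)) %% n = s i.
  by move=> ik; rewrite /= addnK_modn ?sn.
apply: (@cycle_of_path _ _ _ _ _ g) => //.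
- by apply: val_inj; rewrite /= s0 addn0 modn_small.
- apply: val_inj; rewrite /= sk modnDmr addnCA.
  by rewrite subnKC ?(ltnW (ltn_ord x)) // modnDr modn_small.
- move=> i j; rewrite !inE => ik jk gij; apply: sinj => //.
  by rewrite -gK // gij gK.
- move=> i ik; rewrite /circulant /= diff_shift_modn ?sP ?sn //.
  exact: ltnW.
Qed.

(* The cycle closed by the partial sums 0, T+1, T+2, ..., T+k-1, T. *)
Lemma circulant_short_cycle (n k T : nat) (P : pred nat) (x y : 'I_n) :
  simple_graph (@circulant n P) -> x != y ->
  1 < k -> 0 < T -> T + k <= n -> T = (y + (n - x)) %% n ->
  P T.+1 -> P 1 -> P (n - k.-1) ->
  contains (@cycle_graph k.+1) (add_edge (@circulant n P) x y).
Proof.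
move=> es xy k1 T0 Tk TE PT P1 Pk.
pose s i := if i == 0 then 0 else if i == k then T else T + i.
apply: (@circulant_cycle _ _ _ s) => //; rewrite /s.
- by rewrite eqxx; case: eqP => //; lia.
- by move=> i ik; case: eqP => ?; [|case: eqP => ?]; lia.
- move=> i j; rewrite !inE => ik jk.
  by do 2![case: eqP => ?; [|case: eqP => ?]]; lia.
- move=> i ik /=; rewrite (ltn_eqF ik) diff_modn; first last.
  + by case: eqP; lia.
  + by case: eqP; lia.
  case: (i =P 0) => [->|/eqP i0].
    by case: eqP => /= ?; [lia | rewrite subn0 addn1].
  case: eqP => ik'.
    by rewrite ifN; [move: Pk; congr (is_true (P _))|]; lia.
  by rewrite ifT; [move: P1; congr (is_true (P _))|]; lia.
Qed.

(** * Even order: the complete bipartite graph *)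

Lemma odd_circulant_saturated (n l : nat) :
  ~~ odd n -> ~~ odd l -> 1 < l -> l.*2 <= n ->
  simple_graph (@circulant n odd) /\
  saturated (@cycle_graph l.+1) (@circulant n odd).
Proof.
move=> nev lev l1 ln.
have es : simple_graph (@circulant n odd) by apply: circulant_simple => // d; lia.
have eE (u v : 'I_n) : circulant odd u v = odd (u + v).
  have un := ltn_ord u; have vn := ltn_ord v.
  by rewrite /circulant diff_modn //; case: leqP; lia.
split=> //; split.
  case: l l1 lev ln => // l _ lev _ /cycle_steps[f _ fE].
  (* Each of the oddly many edges has an odd end sum, yet the total counts every vertex twice. *)
  have: odd (\sum_i (f i + f (ordS i))) = odd (\sum_(i < l.+2) 1).
    rewrite !(big_morph odd oddD (erefl _)); apply: eq_bigr => i _.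
    by rewrite -eE fE.
  rewrite big_split /= [X in X + _](reindex_inj (@ordS_inj _)) /=.
  by rewrite sum1_card card_ord; lia.
move=> x y xy; rewrite eE => xyev.
(* Exchanging [x] and [y] replaces the difference T by n - T; the smaller one leaves room for T + l
   <= n. *)
wlog le : x y xy xyev / (y + (n - x)) %% n <= n./2.
  move=> th; case: (leqP ((y + (n - x)) %% n) n./2); first exact: th.
  have xn := ltn_ord x; have yn := ltn_ord y.
  move=> lt; apply: contains_add_edgeC; apply: th; rewrite 1?eq_sym //.
    by rewrite addnC.
  by move: lt; rewrite !diff_modn //; case: (leqP x y); case: (leqP y x); lia.
have xyv : x != y :> nat by [].
move: le; have xn := ltn_ord x; have yn := ltn_ord y.
set T := (_ %% n) => le.
have [T0 Tev] : 0 < T /\ ~~ odd T by rewrite /T diff_modn //; case: (leqP x y); lia.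
by apply: (@circulant_short_cycle _ _ T) => //=; lia.
Qed.

(** * The numerical semigroup *)

(* Membership of z in the semigroup X. *)
Definition good (c z : nat) : bool := (z == 0) || (c <= z) && (z.+1 != c.*2).

(** Two nonzero elements are at least [c], so their sum exceeds the gap 2c - 1. *)
Lemma goodD (c x y : nat) : 0 < c -> good c x -> good c y -> good c (x + y).
Proof. by rewrite /good; lia. Qed.

Lemma good_sum (c : nat) (I : finType) (z : I -> nat) : 0 < c ->
  (forall i, good c (z i)) -> good c (\sum_i z i).
Proof. by move=> c0 zg; apply: (big_ind (good c)) => // x y; apply: goodD. Qed.

Lemma good_decomposition (c b k y : nat) : 0 < c -> c * 4 <= b ->
  y <= k * b -> good c y ->
  exists2 x : nat -> nat, forall i, good c (x i) && (x i <= b) &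
    \sum_(0 <= i < k) x i = y.
Proof.
move=> c0 cb; elim: k y => [|k IH] y yk yg.
  exists (fun=> 0) => //; rewrite big_geq //.
  by move: yk; rewrite mul0n leqn0 => /eqP.
(* Greedy choice: for [y > b] both [t] and the remainder [y - t] are at least 2c, hence good. *)
pose t := if y <= b then y else minn b (y - c.*2).
have [tg tb] : good c t /\ t <= b.
  by move: yg; rewrite /t /good; case: (leqP y b); lia.
have [||x xg xE] := IH (y - t).
- move: yk; rewrite /t mulSn; case: (leqP y b).
    by lia.
  by case: (k) => [|?]; rewrite ?mulSn; lia.
- by move: yg; rewrite /t /good; case: (leqP y b); lia.
exists (fun i => if i == k then t else x i).
  by move=> i; case: eqP => // _; rewrite tg.
rewrite big_nat_recr //= eqxx (eq_big_nat _ _ (F2 := x)) ?xE.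
  by rewrite /t; case: (leqP y b); lia.
by move=> i /andP[_ ik]; rewrite (ltn_eqF ik).
Qed.

(** * Odd order: the circulant graph built from the semigroup *)

(* Adjacency in the graph for odd n: m is the absolute value of the odd
   representative of d in (-n, n). *)
Definition conn (n a c d : nat) : bool :=
  let m := if odd d then d else n - d in (m <= a) && good c (a - m)./2.

Section OddOrder.

Variables n a c l : nat.
Hypotheses (n_odd : odd n) (a_odd : odd a) (l_even : ~~ odd l) (l1 : 1 < l).
Hypotheses (c0 : 0 < c) (ca : 8 * c + l < a).
Hypothesis nE : l.+1 * a = n + c * 4 - 2.

Lemma order_large : a + 4 * c + l.*2 < n.
Proof.
have : a * 2 <= l * a by rewrite mulnC leq_mul2r l1 orbT.
by move: nE; rewrite mulSn; lia.
Qed.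

Lemma conn_simple : simple_graph (@circulant n (conn n a c)).
Proof.
apply: circulant_simple => [|d dn]; rewrite /conn /=.
  by rewrite subn0; have := order_large; lia.
have -> : odd (n - d) = ~~ odd d by lia.
by case: (odd d) => //=; have -> : n - (n - d) = d by lia.
Qed.

(* With p = (z, (k1, k2)), the odd integer a - 2z in [-a, a] is congruent to
   v - u modulo n; k1 and k2 keep the congruence in nat. *)
Lemma conn_step (u v : 'I_n) : circulant (conn n a c) u v ->
  exists p : nat * (nat * nat),
    [/\ v + p.1.*2 + n * p.2.1 = u + a + n * p.2.2, p.1 <= a,
        good c p.1 & good c (a - p.1)].
Proof.
have un := ltn_ord u; have vn := ltn_ord v.
have nn : n * 0 = 0 /\ n * 1 = n /\ n * 2 = n * 1 + n by lia.
rewrite /circulant /conn diff_modn //; set d := (X in odd X).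
have dn : d < n by rewrite /d; case: (leqP u v); lia.
have dE : v + n = u + d + n * (u <= v).
  by rewrite /d; case: (leqP u v); lia.
rewrite /good; case: ifP => dodd /andP[da dg].
  exists ((a - d)./2, (1, u <= v : nat)); split => /=; rewrite /good; try lia.
exists ((a + (n - d))./2, (0, u <= v : nat)); split => /=; rewrite /good; try lia.
Qed.

Lemma conn_cycle_free :
  ~ contains (@cycle_graph l.+1) (@circulant n (conn n a c)).
Proof.
have large := order_large.
move=> cyc; have [k lE] : exists k, l = k.+1 by exists l.-1; lia.
move: cyc; rewrite lE => /cycle_steps[f _ fE].
have /fin_all_exists[p pP] i := conn_step (fE i).
have zg : good c (\sum_i (p i).1) by apply: good_sum => // i; case: (pP i).
(* The complementary sum serves the cycles whose steps add up to -n. *)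
have zg' : good c (\sum_i (a - (p i).1)).
  by apply: good_sum => // i; case: (pP i).
have nE' : k.+2 * a = n + c * 4 - 2 by rewrite -lE.
have zS : \sum_i (p i).1 + \sum_i (a - (p i).1) = n + c * 4 - 2.
  rewrite -big_split /= (eq_bigr (fun=> a)) => [|i _].
    by rewrite sum_nat_const card_ord.
  by case: (pP i) => _ ? _ _; lia.
have: \sum_i (f (ordS i) + (p i).1.*2 + n * (p i).2.1)
      = \sum_i (f i + a + n * (p i).2.2).
  by apply: eq_bigr => i _; case: (pP i).
rewrite !big_split /= -!big_distrr /= [X in X + _ + _ = _](_ : _ = \sum_i f i).
  rewrite sum_nat_const card_ord nE'.
  rewrite -(big_morph double doubleD double0).
  move: zg zg' zS; rewrite /good.
  set Z := \sum_i (p i).1; set Z' := \sum_i (a - _); set K1 := \sum_i _.2.1.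
  set K2 := \sum_i _.2.2.
  move=> zg zg' zS; set F := \sum_i _ => eqF.
  have n0 : 0 < n by lia.
  have eqZ : Z.*2 + n * K1 = n * K2.+1 + (c * 4 - 2) by rewrite mulnS; lia.
  have K12 : K1 <= K2.+1 by rewrite -ltnS -(ltn_pmul2l n0) (mulnS n K2.+1); lia.
  have /subnK KE := K12.
  set J := K2.+1 - K1 in KE.
  have nKE : n * K2.+1 = n * J + n * K1 by rewrite -mulnDr KE.
  have eqJ : Z.*2 = n * J + (c * 4 - 2) by lia.
  have J3 : J < 3 by rewrite -(ltn_pmul2l n0); lia.
  (* J = 0 gives Z = 2c - 1 and J = 2 gives Z' = 2c - 1, neither of them good; J = 1 fails by
     parity, as [n] is odd. *)
  by case: J J3 eqJ {KE nKE} => [|[|[]]] // _; lia.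
by rewrite [RHS](reindex_inj (@ordS_inj _)).
Qed.

Lemma conn_increasing_cycle (x y : 'I_n) (z : nat) : x != y ->
  l <= (y + (n - x)) %% n -> (y + (n - x)) %% n + z.*2 = l * a -> good c z ->
  contains (@cycle_graph l.+1) (add_edge (@circulant n (conn n a c)) x y).
Proof.
move=> xy lT zE zg.
have laE : l * a = (l * a./2).*2 + l.
  by rewrite -{1}(odd_double_half a) a_odd mulnDr muln1 -doubleMr addnC.
(* Since [a] is odd, the bound [a./2] keeps each step a - 2w positive; [l <= T] gives
   [z <= l * a./2]. *)
have [||||w wP wE] := @good_decomposition c a./2 l z; rewrite //.
- by lia.
- by lia.
pose s i := \sum_(0 <= j < i) (a - (w j).*2).
have sS i : s i.+1 = s i + (a - (w i).*2) by rewrite /s big_nat_recr.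
have wa i : (w i).*2 < a by case/andP: (wP i) => _; lia.
have smono : {homo s : i j / i < j}.
  by apply: homo_ltn ltn_trans _ => i; rewrite sS; have := wa i; lia.
have sl : s l = (y + (n - x)) %% n.
  have: s l + z.*2 = l * a; last by lia.
  rewrite -wE (big_morph double doubleD double0) -big_split /=.
  rewrite (eq_bigr (fun=> a)) => [|i _]; last by have := wa i; lia.
  by rewrite sum_nat_const_nat subn0.
have n0 : 0 < n by lia.
have sn i : i <= l -> s i < n.
  move=> il; apply: leq_ltn_trans (_ : s l < n); last by rewrite sl ltn_mod.
  by move: il; rewrite leq_eqVlt => /predU1P[->|/smono/ltnW].
apply: (@circulant_cycle _ _ _ s) => //.
- exact: conn_simple.
- by rewrite /s big_geq.
- by move=> i j _ _ sij; case: (ltngtP i j) => // /smono; rewrite sij ltnn.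
- move=> i il; have := sn _ il; have := sn _ (ltnW il) => ? ?.
  rewrite diff_modn // sS leq_addr addKn /conn.
  have -> : odd (a - (w i).*2) by have := wa i; lia.
  rewrite leq_subr; have -> : (a - (a - (w i).*2))./2 = w i.
    by have := wa i; lia.
  by case/andP: (wP i).
Qed.

Lemma conn_saturated :
  saturated (@cycle_graph l.+1) (@circulant n (conn n a c)).
Proof.
split=> [|x y xy]; first exact: conn_cycle_free.
have [sym _] := conn_simple.
(* As [n] is odd, exactly one of T and n - T is even. *)
wlog Tev : x y xy / ~~ odd ((y + (n - x)) %% n).
  move=> th; have [Todd nxy|Tev] := boolP (odd ((y + (n - x)) %% n)); last exact: th.
  apply: contains_add_edgeC; apply: th; rewrite 1?eq_sym 1?sym //.
  have xyv : x != y :> nat by [].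
  have xn := ltn_ord x; have yn := ltn_ord y.
  by move: Todd; rewrite !diff_modn //; case: (leqP x y); case: (leqP y x); lia.
have xyv : x != y :> nat by [].
have xn := ltn_ord x; have yn := ltn_ord y.
rewrite /circulant; set T := (_ %% n) in Tev *.
have [T0 Tn] : 0 < T /\ T < n.
  by rewrite /T diff_modn //; case: (leqP x y); lia.
rewrite {1}/conn (negbTE Tev) => nT.
have large := order_large.
(* The sum of [l] positive odd steps is at least [l], so a smaller T needs a backward step, of
   length l - 1. *)
case: (ltnP T l) => Tl.
  apply: (@circulant_short_cycle _ _ T) => //.
  - exact: conn_simple.
  - by lia.
  - by rewrite /conn /= Tev /good; lia.
  - by rewrite /conn /good /=; lia.
  - rewrite /conn; have -> : odd (n - l.-1) = false by lia.
    by rewrite /good; lia.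
(* With w = (a - (n - T))/2 as a signed integer, z = 2c - 1 - w: non-adjacency says that w is
   negative or not good, and either way z is good. *)
have [Tla yg] : T <= l * a /\ good c (l * a - T)./2.
  by move: nT; rewrite /good; move: nE; rewrite mulSn; lia.
have yE : T + (l * a - T)./2.*2 = l * a.
  have lae : ~~ odd (l * a) by rewrite oddM (negbTE l_even).
  by lia.
exact: conn_increasing_cycle Tl yE yg.
Qed.

End OddOrder.

(** * Choice of the parameters *)

Lemma odd_parameters (l n : nat) :
  ~~ odd l -> odd n -> 12 * l ^ 2 + 36 * l + 24 < n ->
  exists a c : nat,
    [/\ odd a, 0 < c, 8 * c + l < a & l.+1 * a = n + c * 4 - 2].
Proof.
move=> lev nodd nl; have nE := divn_eq n l.+1.
have := ltn_mod n l.+1; rewrite ltn0Sn; move: nE.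
set b := n %/ _; set r := n %% _ => nE rl.
(* The lower bound on [n] factors as (12l + 24)(l + 1). *)
have bl : 12 * l + 23 < b by nia.
(* The congruence makes [c] an integer and forces [a] to be odd; [a <= b + 4] keeps [c] at most l +
   1. *)
have [a [ba ab aE]] : exists a, [/\ b < a, a <= b + 4 &
    (l.+1 * a) %% 4 = (n + 2) %% 4].
  have : l.+1 %% 4 = 1 \/ l.+1 %% 4 = 3 by lia.
  have red a : l.+1 * a %% 4 = l.+1 %% 4 * (a %% 4) %% 4 by rewrite modnMm.
  have res t : t < 4 -> exists a, [/\ b < a, a <= b + 4 & a %% 4 = t].
    (* The factor 3 stands for -1 modulo 4. *)
    move=> t4; exists (b.+1 + (t + 3 * (b.+1 %% 4)) %% 4).
    by clear -t4; split; lia.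
  case=> l4.
    have [|a [ba ab at4]] := res ((n + 2) %% 4); first exact: ltn_pmod.
    by exists a; split; rewrite // red l4 at4; lia.
  have [|a [ba ab at4]] := res (3 * (n + 2) %% 4); first exact: ltn_pmod.
  by exists a; split; rewrite // red l4 at4; lia.
exists a, ((l.+1 * a + 2 - n) %/ 4).
have la : l.+1 + l.+1 * b <= l.+1 * a by rewrite -mulnS leq_mul2l.
have la4 : l.+1 * a <= l.+1 * b + l.+1 * 4 by rewrite -mulnDr leq_mul2l.
have aodd : odd a by have := oddM l.+1 a; lia.
by split; lia.
Qed.

Theorem theorem1p2 (l n : nat) :
  4 <= l -> ~~ odd l -> 12 * l ^ 2 + 36 * l + 24 < n ->
  exists e : rel 'I_n,
    [/\ simple_graph e, regular e & saturated (@cycle_graph l.+1) e].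
Proof.
move=> l4 lev nl; have [nodd|nev] := boolP (odd n).
  have [a [c [aodd c0 ca nE]]] := odd_parameters lev nodd nl.
  exists (circulant (conn n a c)); split.
  - by apply: (@conn_simple n a c l) => //; lia.
  - exact: circulant_regular.
  - by apply: conn_saturated nE => //; lia.
have [||es sat] := @odd_circulant_saturated n l nev lev; [by lia|by nia|].
by exists (circulant odd); split=> //; apply: circulant_regular.
Qed.
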